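(* Let $t \ge 3$ and let $G$ be a graph with $m$ edges. For each $T \in \mathcal{K}_t(G)$ define \[ \beta_G(T) = \max\{k : T \subseteq V(S) \text{ for some subgraph } S \subseteq G \text{ with } S \cong P_{k+1}\} \quad\text{and}\quad p'_G(T) = \frac{1}{\binom{\beta_G(T)-1}{t-2}}. \] Then $p'_G(T)$ is well-defined and decreasing in $\beta_G(T)$, and \[ \sum_{T \in \mathcal{K}_t(G)} p'_G(T) \le \frac{m}{\binom{t}{2}}, \] with equality if and only if $G$ is a disjoint union of complete graphs of order at least $t$ together with any number of isolated vertices.
   Context: $P_{k+1}$ denotes the path with $k+1$ vertices and $k$ edges. For a graph $G$, $\mathcal{K}_t(G) = \{S \subseteq V(G) : G[S] \cong K_t\}$. *)

(* Defs.v *)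
(* A finite simple graph is a symmetric irreflexive relation on a finType. *)
From mathcomp Require Import all_boot all_order all_algebra.

Set Implicit Arguments.
Unset Strict Implicit.
Unset Printing Implicit Defensive.

Import Order.TTheory GRing.Theory Num.Theory.

Definition graph_iso (U V : finType) (r : rel U) (s : rel V) : bool :=
  [exists f : {ffun U -> V},
    [&& injectiveb f, [forall y, y \in codom f]
      & [forall x, forall y, s (f x) (f y) == r x y]]].

(* The complete graph K_n and the path P_n, both on n vertices. *)
Definition complete_graph (n : nat) : rel 'I_n := [rel i j | i != j].

Definition path_graph (n : nat) : rel 'I_n :=
  [rel i j : 'I_n | (i.+1 == j :> nat) || (j.+1 == i :> nat)].

Section Graph.

Variables (V : finType) (e : rel V).

Definition edges : {set {set V}} :=
  [set [set p.1; p.2] | p : V * V & e p.1 p.2].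

Definition induced (S : {set V}) : rel {x : V | x \in S} :=
  [rel x y | e (val x) (val y)].

Definition cliques (t : nat) : {set {set V}} :=
  [set S : {set V} | graph_iso (@induced S) (@complete_graph t)].

(* A subgraph has its own vertex set W and edge set F; it need not be
   induced. *)
Definition is_subgraph (W : {set V}) (F : {set {set V}}) : bool :=
  (F \subset edges) && [forall A in F, A \subset W].

Definition subgraph_rel (W : {set V}) (F : {set {set V}}) :
    rel {x : V | x \in W} :=
  [rel x y | [set val x; val y] \in F].

(* The path has k edges, hence k.+1 vertices. *)
Definition in_path (T : {set V}) (k : nat) : bool :=
  [exists W : {set V}, exists F : {set {set V}},
    [&& is_subgraph W F, graph_iso (@subgraph_rel W F) (@path_graph k.+1)
      & T \subset W]].

(* Since k.+1 <= #|V| for every path, the bound k < #|V| loses nothing.  The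
   value is 0 when no path contains T. *)
Definition beta (T : {set V}) : nat := \max_(k < #|V| | in_path T k) k.

Definition disjoint_union_of_complete (t : nat) : Prop :=
  exists P : {set {set V}},
    [/\ partition P [set: V],
        forall B, B \in P -> t <= #|B| \/ #|B| = 1
      & forall x y, e x y = (x != y) && [exists B in P, (x \in B) && (y \in B)]].

End Graph.

(* In rat the inverse of 0 is 0, so this is the intended value only when
   t - 2 <= b - 1. *)
Definition path_weight (t b : nat) : rat := (('C(b - 1, t - 2))%:R^-1)%R.

Definition p' (V : finType) (e : rel V) (t : nat) (T : {set V}) : rat :=
  path_weight t (beta e T).

(* Main.v *)
(* Induct on the number of edges, taking a longest path P, with k edges and
   vertex set W.  If the degrees of its ends sum to more than k, then W carries
   a spanning cycle; as P is longest, W is then a union of components and every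
   clique T in W has beta T = k.  Each edge in W lies in at most C(k-1, t-2) of
   these cliques, so W contributes at most its share of the bound, with equality
   only if every t-set in W containing an edge is a clique, i.e. W is complete.
   Otherwise some end x has degree d <= k/2 and all its neighbours on P.
   Deleting x loses d edges and at most C(d, t-1) cliques, all with beta = k, and
   C(t,2) C(d, t-1) < d C(k-1, t-2), so the inequality is strict.  Passing to a
   subgraph decreases beta, hence increases the weights of the remaining
   cliques. *)
Require Import Defs.
From mathcomp Require Import all_boot all_order all_algebra.
From mathcomp Require Import zify lra.

Set Implicit Arguments.
Unset Strict Implicit.
Unset Printing Implicit Defensive.

Import Order.TTheory GRing.Theory Num.Theory.
Local Open Scope ring_scope.

(** * Binomial coefficients and subsets *)

(** Factor by factor in the falling factorials, [2n - i >= 2(n - i)]. *)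
Lemma double_bin_ge n r : (2 ^ r * 'C(n, r) <= 'C(n.*2, r))%N.
Proof.
elim: r => [|r IHr]; first by rewrite !bin0.
rewrite -(leq_pmul2l (ltn0Sn r)) mulnCA (mul_bin_left n) (mul_bin_left n.*2).
rewrite expnS [(2 * _)%N]mulnC -mulnA [(2 * _)%N]mulnA mulnCA.
by apply: leq_mul IHr; lia.
Qed.

(* Deleting a vertex of degree [d <= k / 2] loses [d] edges and at most
   ['C(d, t - 1)] cliques, each of weight [1 / 'C(k - 1, t - 2)]. *)
Lemma bin_deletion_ineq t d k : (2 < t -> 0 < d -> d.*2 <= k -> t - 1 <= k ->
  'C(t, 2) * 'C(d, t - 1) < d * 'C(k - 1, t - 2))%N.
Proof.
case: t => [|[|r]] // r_gt0 d_gt0 dk rk; rewrite subSS subn0 !subn2 /=.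
case: d d_gt0 dk => // d _ dk.
(* With [t = r + 2] and degree [d + 1], absorption extracts the factor [d + 1]; what remains is
   [(r + 2) C(d, r) < 2 C(k - 1, r)]. *)
have E : ('C(r.+2, 2) * 'C(d.+1, r.+1) * 2 = r.+2 * (d.+1 * 'C(d, r)))%N.
  have := mul_bin_diag d.+1 r; have := mul_bin_diag r.+2 1.
  by rewrite bin1 /=; nia.
rewrite -(ltn_pmul2r (isT : 0 < 2)%N) E mulnCA -mulnA ltn_pmul2l //.
have C_gt0 : (0 < 'C(k - 1, r))%N by rewrite bin_gt0; lia.
have le1 : (2 ^ r * 'C(d, r) <= 'C(k - 1, r))%N.
  by apply: leq_trans (double_bin_ge d r) _; apply: leq_bin2l; lia.
(* Strictness comes from here and needs [r > 0], that is [t > 2]. *)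
have le2 : (r.+2 < 2 ^ r * 2)%N.
  elim: r {E rk C_gt0 le1} r_gt0 => // -[//|r] IHr _.
  by move: (IHr isT); rewrite !expnS; lia.
case: (posnP 'C(d, r)) => [->|Cd_gt0]; first by rewrite muln0 muln_gt0 C_gt0.
by nia.
Qed.

(** Adding [E] maps the [(t - #|E|)]-subsets of [B :\: E] bijectively onto the sets counted. *)
Lemma card_subsets_between (V : finType) (E B : {set V}) t :
  E \subset B -> (#|E| <= t)%N ->
  #|[set T : {set V} | (E \subset T) && (T \subset B) && (#|T| == t)]|
    = 'C(#|B| - #|E|, t - #|E|).
Proof.
move=> EB Et.
have <- : #|B :\: E| = (#|B| - #|E|)%N by rewrite cardsD (setIidPr EB).
rewrite -cards_draws.
rewrite -[RHS](@card_in_imset _ _ (fun A => A :|: E)).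
  apply: eq_card => T; rewrite !inE; apply/idP/imsetP.
    move=> /andP[/andP[ET TB] /eqP Tt]; exists (T :\: E).
      by rewrite !inE setSD //= cardsD (setIidPr ET) Tt.
    by rewrite setUC setDE setUIr setUCr setIT (setUidPr ET).
  move=> [A]; rewrite !inE subsetD => /andP[/andP[AB dAE] /eqP cA] ->.
  rewrite subsetUr subUset AB EB /= cardsU cA.
  by rewrite (disjoint_setI0 dAE) cards0; apply/eqP; lia.
move=> A1 A2; rewrite !inE !subsetD.
move=> /andP[/andP[_ d1] _] /andP[/andP[_ d2] _] /(congr1 (fun A => A :\: E)) /=.
by rewrite !setDUl setDv !setU0 (setDidPl d1) (setDidPl d2).
Qed.

Lemma set2_eq_cases (T : finType) (x y a b : T) :
  [set x; y] = [set a; b] -> (x = a /\ y = b) \/ (x = b /\ y = a).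
Proof.
move=> E; move: (set21 x y) (set22 x y) (set21 a b) (set22 a b).
by rewrite E -{3 4}E; do 4!case/set2P=> ?; subst; auto.
Qed.

(** * Edges, cliques and paths *)

Section Graph.

Variables (V : finType) (e : rel V).
Hypotheses (e_sym : symmetric e) (e_irr : irreflexive e).

Lemma edge_in x y : ([set x; y] \in edges e) = e x y.
Proof.
apply/imsetP/idP => [[[a b]]|exy]; last by exists (x, y); rewrite ?inE.
by rewrite inE /= => eab /set2_eq_cases[[-> ->]|[-> ->]] //; rewrite e_sym.
Qed.

Lemma edgesP (E : {set V}) :
  reflect (exists x y, e x y /\ E = [set x; y]) (E \in edges e).
Proof.
apply: (iffP imsetP) => [[[x y]]|[x [y [exy ->]]]].
  by rewrite inE => exy ->; exists x, y.
by exists (x, y); rewrite ?inE.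
Qed.

(** Replaces the isomorphism by pairwise adjacency; for the converse, the rank in the enumeration of
    [T] is an isomorphism. *)
Lemma cliquesP t (T : {set V}) :
  reflect (#|T| = t /\ {in T &, forall x y, x != y -> e x y})
          (T \in cliques e t).
Proof.
rewrite inE; apply: (iffP existsP) => [[f]|[Tt Te]].
  case/and3P => /injectiveP f_inj /forallP f_surj /forallP f_iso; split.
    rewrite -[RHS]card_ord -(card_sig (mem T)) -(card_codom f_inj).
    by apply: eq_card => i; rewrite f_surj.
  move=> x y xT yT xy; pose x' : {x | x \in T} := exist _ x xT.
  pose y' : {x | x \in T} := exist _ y yT.
  have <- : (f x' != f y') = e x y by exact: eqP (forallP (f_iso x') y').
  by rewrite (inj_eq f_inj) -(inj_eq val_inj).
subst t.
pose f := [ffun x : {x | x \in T} => enum_rank_in (valP x) (val x)].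
have fK x : enum_val (f x) = val x by rewrite ffunE enum_rankK_in // (valP x).
have f_inj : injective f.
  by move=> x y /(congr1 enum_val); rewrite !fK => /val_inj.
exists f; apply/and3P; split; first exact/injectiveP.
  apply/forallP => i; apply/codomP; exists (exist _ (enum_val i) (enum_valP i)).
  by apply: enum_val_inj; rewrite fK.
apply/forallP => x; apply/forallP => y; apply/eqP.
change ((f x != f y) = e (val x) (val y)); rewrite (inj_eq f_inj).
case: (eqVneq x y) => [->|xy]; first by rewrite e_irr.
by symmetry; apply: Te; rewrite ?(valP x) ?(valP y) // (inj_eq val_inj).
Qed.

(** Turns subgraphs isomorphic to a path into duplicate-free sequences: the inverse isomorphism is
    read off at [0, ..., k], and conversely [index] gives the isomorphism. *)
Lemma in_pathP (T : {set V}) k :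
  reflect (exists s, [/\ size s = k.+1, uniq s, sorted e s & {subset T <= s}])
          (in_path e T k).
Proof.
apply: (iffP existsP) => [[W /existsP[F /and3P[]]]|[s [sk s_uniq s_path Ts]]].
  case/andP => F_e _ /existsP[f /and3P[/injectiveP f_inj /forallP f_surj]].
  move=> /forallP f_iso /subsetP TW.
  pose g i := iinv (f_surj i); have gK i : f (g i) = i by exact: f_iinv.
  pose v i := val (g (inord i)); exists (mkseq v k.+1); split.
  - exact: size_mkseq.
  - apply/mkseq_uniqP => i j ik jk /val_inj /(can_inj gK) /(congr1 val) /=.
    by rewrite !inordK.
  - apply/(sortedP (v 0)) => i; rewrite size_mkseq => ik.
    rewrite !nth_mkseq ?(ltnW ik) // -edge_in; apply: (subsetP F_e).
    have <- : path_graph (inord i : 'I_k.+1) (inord i.+1)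
      = ([set v i; v i.+1] \in F).
      by have := eqP (forallP (f_iso (g (inord i))) (g (inord i.+1))); rewrite !gK.
    by rewrite /path_graph /= !inordK ?eqxx // ltnW.
  - move=> x /TW xW; pose i := f (exist _ x xW); apply/mapP; exists (val i).
      by rewrite mem_iota /=.
    by rewrite /v inord_val (f_inj _ _ (gK i)).
exists [set x in s].
(* Only consecutive pairs are taken: chords of [s] would spoil the isomorphism. *)
pose F := [set [set p.1; p.2] | p in [set p : V * V |
  (p.1 \in s) && (p.2 \in s) && ((index p.1 s).+1 == index p.2 s)]].
have F_e : F \subset edges e.
  apply/subsetP => E /imsetP[[x y]]; rewrite inE /= => /andP[/andP[xs ys] /eqP xy] ->.
  rewrite edge_in -(nth_index x xs) -(nth_index x ys) -xy.
  by apply/sortedP; rewrite // xy index_mem.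
have inF x y : x \in s -> y \in s -> ([set x; y] \in F)
    = ((index x s).+1 == index y s) || ((index y s).+1 == index x s).
  move=> xs ys; apply/idP/orP => [xyF|[]]; last first.
  - by move=> xy; apply/imsetP; exists (y, x); rewrite ?inE /= ?xs ?ys // setUC.
  - by move=> xy; apply/imsetP; exists (x, y); rewrite ?inE /= ?xs ?ys.
  case/imsetP: xyF => -[a b]; rewrite inE /= => /andP[_ ab].
  by case/set2_eq_cases => -[-> ->]; rewrite ab; auto.
apply/existsP; exists F; apply/and3P; split; last by apply/subsetP => x /Ts; rewrite inE.
  rewrite /is_subgraph F_e; apply/forallP => A; apply/implyP => /imsetP[p].
  rewrite inE => /andP[/andP[ps1 ps2] _] ->.
  by apply/subsetP => z /set2P[] ->; rewrite inE.
have ind_lt (x : V) : x \in [set x in s] -> (index x s < k.+1)%N.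
  by rewrite inE -sk index_mem.
apply/existsP; exists [ffun x => Ordinal (ind_lt (val x) (valP x))].
have xs (x : {x | x \in [set x in s]}) : val x \in s by have := valP x; rewrite inE.
apply/and3P; split.
- apply/injectiveP => x y; rewrite !ffunE => /(congr1 val) /= ixy; apply: val_inj.
  by rewrite -(nth_index (val x) (xs x)) ixy nth_index ?xs.
- apply/forallP => i; apply/codomP.
  have i_s : (i < size s)%N by rewrite sk ltn_ord.
  have [x0 _] : exists x, x \in s.
    by case: (s) i_s => // x s' _; exists x; apply: mem_head.
  have iW : nth x0 s i \in [set x in s] by rewrite inE mem_nth.
  by exists (exist _ (nth x0 s i) iW); apply: val_inj; rewrite ffunE /= index_uniq.
- apply/forallP => x; apply/forallP => y.
  by rewrite !ffunE; apply/eqP; rewrite /subgraph_rel /= inF ?xs.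
Qed.

End Graph.

(** * Longest paths *)

Definition neighbours (V : finType) (e : rel V) (x : V) : {set V} :=
  [set y | e x y].

Section LongestPath.

Variables (V : finType) (e : rel V).
Hypotheses (e_sym : symmetric e) (e_irr : irreflexive e).

Definition longest_path (s : seq V) : Prop :=
  [/\ uniq s, sorted e s
    & forall s', uniq s' -> sorted e s' -> (size s' <= size s)%N].

(** Path orders are bounded by [#|V|], and the given edge is a path on two vertices, so a maximum
    exists and is at least 2. *)
Lemma exists_longest_path x y : e x y ->
  exists z p, (0 < size p)%N /\ longest_path (z :: p).
Proof.
move=> exy; pose P k := [exists s : k.-tuple V, uniq s && sorted e s].
have inP s : uniq s -> sorted e s -> P (size s).
  by move=> us ss; apply/existsP; exists (in_tuple s); rewrite us.
have P2 : P 2.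
  apply: (inP [:: x; y]); rewrite /= ?exy // inE andbT.
  by apply: contraL exy => /eqP->; rewrite e_irr.
have leP k : P k -> (k <= #|V|)%N.
  by case/existsP => s /andP[/card_uniqP us _]; rewrite -(size_tuple s) -us max_card.
case: (ex_maxnP (ex_intro _ 2 P2) leP) => k /existsP[s /andP[us ss]] kmax.
have := kmax 2 P2; have := size_tuple s.
case Es: (tval s) us ss => [|z [|z' p]] us ss <- // _.
exists z, (z' :: p); split=> //; split=> // s' us' ss'.
by have := kmax _ (inP _ us' ss'); rewrite -(size_tuple s) Es.
Qed.

Lemma longest_path_rev s : longest_path s -> longest_path (rev s).
Proof.
case=> us ss smax; split; rewrite ?rev_uniq // ?size_rev //.
by rewrite rev_sorted (eq_sorted (e' := e)) // => a b; rewrite e_sym.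
Qed.

(** A neighbour off the path could be prepended to it. *)
Lemma longest_path_head x p :
  longest_path (x :: p) -> {subset neighbours e x <= x :: p}.
Proof.
case=> us ss smax y; rewrite inE => exy; apply: contraT => y_p.
have : (size (y :: x :: p) <= size (x :: p))%N; last by rewrite ltnn.
by apply: smax; [rewrite cons_uniq y_p | rewrite /= e_sym exy].
Qed.

Lemma longest_path_last x p :
  longest_path (x :: p) -> {subset neighbours e (last x p) <= x :: p}.
Proof.
move=> /longest_path_rev; rewrite lastI rev_rcons => /longest_path_head sub y.
by move=> /sub; rewrite !inE mem_rev mem_rcons inE.
Qed.

(* The neighbours of the first vertex, shifted one step back along the path,
   and those of the last vertex overlap when there are too many of them. *)
Lemma spanning_cycle x p : uniq (x :: p) -> path e x p ->
  {subset neighbours e x <= x :: p} ->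
  {subset neighbours e (last x p) <= x :: p} ->
  (size p < #|neighbours e x| + #|neighbours e (last x p)|)%N ->
  exists c, [/\ uniq c, cycle e c & c =i x :: p].
Proof.
move=> us xp sub_x sub_y deg; set y := last x p in sub_y deg.
(* [nth x p i] is the successor of [nth x (x :: p) i] on the path, so an index in both sets gives
   consecutive vertices, the later adjacent to [x] and the earlier to [y]. *)
pose A := [set i : 'I_(size p) | e x (nth x p i)].
pose B := [set i : 'I_(size p) | e (nth x (x :: p) i) y].
have cA : (#|neighbours e x| <= #|A|)%N.
  apply: leq_trans (leq_imset_card (fun i : 'I__ => nth x p i) A).
  apply/subset_leq_card/subsetP => z zx; move: (sub_x _ zx).
  rewrite inE in zx; rewrite inE => /orP[/eqP zx'|zp]; first by rewrite zx' e_irr in zx.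
  have zi : (index z p < size p)%N by rewrite index_mem.
  by apply/imsetP; exists (Ordinal zi); rewrite ?inE /= nth_index.
have cB : (#|neighbours e y| <= #|B|)%N.
  apply: leq_trans (leq_imset_card (fun i : 'I__ => nth x (x :: p) i) B).
  apply/subset_leq_card/subsetP => z zy; move: (sub_y _ zy).
  rewrite inE in zy; move=> zp.
  have zi : (index z (x :: p) < size p)%N.
    have : (index z (x :: p) < size (x :: p))%N by rewrite index_mem.
    rewrite [size _]/= ltnS leq_eqVlt => /orP[/eqP zi|//].
    have : z = y by rewrite -(nth_index x zp) zi /y (last_nth x).
    by move=> zy'; rewrite zy' e_irr in zy.
  by apply/imsetP; exists (Ordinal zi); rewrite ?inE [val _]/= nth_index // e_sym.
have [i] : exists i, i \in A :&: B.
  apply/set0Pn; rewrite -card_gt0; have := cardsUI A B.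
  have : (#|A :|: B| <= size p)%N by rewrite -[X in (_ <= X)%N]card_ord max_card.
  by lia.
rewrite !inE => /andP[exi eiy].
have ip : (i < size p)%N by [].
have nth_i : nth x (x :: p) i = last x (take i p).
  by rewrite (last_nth x) size_takel ?(ltnW ip) //
    -[x :: take i p]/(take i.+1 (x :: p)) nth_take.
move: (cat_take_drop i p) exi eiy; rewrite nth_i (drop_nth x ip).
move: (take i p) (nth x p i) (drop i.+1 p) => q1 z q2 Ep exz ey.
(* From [x] along [q1], across the edge [ey] to the end [y], backwards to [z], and home by the edge
   [exz]. *)
exists (x :: q1 ++ rev (z :: q2)); split.
- apply: etrans us; rewrite -Ep; apply: perm_uniq.
  by rewrite perm_cons perm_cat2l perm_rev.
- move: xp; rewrite -{1}Ep cat_path => /andP[xq1 /= /andP[_ zq2]].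
  rewrite /= rcons_cat cat_path xq1 /=.
  rewrite -[path _ _ _]/(sorted e (last x q1 :: _)) -rev_cons -rev_rcons rev_sorted.
  rewrite (eq_sorted (e' := e)) => [|a b]; last by rewrite e_sym.
  by rewrite /= exz rcons_path zq2 /= e_sym; move: ey; rewrite /y -Ep last_cat.
- by move=> u; rewrite -Ep !inE !mem_cat mem_rev inE.
Qed.

(** Cutting the cycle open at [u] gives a path with the same vertices that starts at [u]; prepending
    an outside neighbour [w] would beat the longest path. *)
Lemma spanning_cycle_closed x p c : longest_path (x :: p) ->
  uniq c -> cycle e c -> c =i x :: p ->
  forall u w, u \in x :: p -> e u w -> w \in x :: p.
Proof.
case=> us _ smax uc cc cp u w up euw; apply: contraT => wp.
have uc' : u \in c by rewrite cp.
have [i c' Ec] := rot_to uc'.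
have szc : size c' = size p.
  have := perm_size (uniq_perm uc us cp); rewrite -(size_rot i) Ec => -[//].
have : (size (w :: u :: c') <= size (x :: p))%N; last by rewrite /= szc ltnn.
apply: smax; first by rewrite cons_uniq -Ec mem_rot cp wp rot_uniq.
rewrite /= e_sym euw; move: cc; rewrite -(rot_cycle i) Ec /= rcons_path.
by case/andP.
Qed.

End LongestPath.

(** * Counting cliques through edges *)

Section PathWeight.

Variable t : nat.
Hypothesis t_gt2 : (2 < t)%N.

(** By Pascal's rule, passing from [b] to [b + 1] adds [C(b - 1, t - 3)] to the binomial, which is
    positive since [t - 1 <= b]. *)
Lemma path_weight_anti b b' : (t - 1 <= b)%N -> (b < b')%N ->
  path_weight t b' < path_weight t b.
Proof.
move=> tb bb'.
have C_gt0 : (0 < 'C(b - 1, t - 2))%N by rewrite bin_gt0; lia.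
have ltC : ('C(b - 1, t - 2) < 'C(b' - 1, t - 2))%N.
  apply: leq_trans (leq_bin2l (t - 2) (_ : b <= b' - 1)%N); last by lia.
  case: b tb {bb'} C_gt0 => [|b] tb; first by lia.
  have -> : (t - 2 = (t - 3).+1)%N by lia.
  by rewrite subn1 /= binS => _; rewrite -[leqLHS]addn1 leq_add2l bin_gt0; lia.
by rewrite /path_weight ltf_pV2 ?ltr_nat // posrE ltr0n // (leq_trans _ ltC).
Qed.

Lemma path_weight_nincr b b' : (t - 1 <= b)%N -> (b <= b')%N ->
  path_weight t b' <= path_weight t b.
Proof.
move=> tb; rewrite leq_eqVlt => /orP[/eqP-> //|bb'].
by apply/ltW/path_weight_anti.
Qed.

End PathWeight.

(** * Attainment of [beta], double counting, and deletion of vertices *)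

Section Counting.

Variables (V : finType) (e : rel V).
Hypotheses (e_sym : symmetric e) (e_irr : irreflexive e).

Lemma in_path_lt_card (T : {set V}) k : in_path e T k -> (k < #|V|)%N.
Proof.
case/(in_pathP e_sym) => s [<- /card_uniqP <- _ _]; exact: max_card.
Qed.

Lemma leq_beta (T : {set V}) k : in_path e T k -> (k <= beta e T)%N.
Proof.
move=> Tk; rewrite /beta.
exact: (@leq_bigmax_cond _ (fun i : 'I_#|V| => in_path e T i)
  (fun i : 'I_#|V| => i : nat) (Ordinal (in_path_lt_card Tk)) Tk).
Qed.

(** The given path makes the maximum range over a nonempty set, so it is not the default value 0. *)
Lemma beta_in_path (T : {set V}) k : in_path e T k -> in_path e T (beta e T).
Proof.
move=> Tk; rewrite /beta.
have [|i Ti ->] := @eq_bigmax_cond _ (fun i : 'I_#|V| => in_path e T i)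
  (fun i => i : nat).
  by apply/card_gt0P; exists (Ordinal (in_path_lt_card Tk)).
exact: Ti.
Qed.

Lemma beta_eq (T : {set V}) k : in_path e T k ->
  (forall j, in_path e T j -> (j <= k)%N) -> beta e T = k.
Proof.
move=> Tk kmax; apply/eqP; rewrite eqn_leq leq_beta // andbT.
exact/kmax/(beta_in_path Tk).
Qed.

Lemma clique_sorted (s : seq V) :
  uniq s -> {in s &, forall x y, x != y -> e x y} -> sorted e s.
Proof.
case: s => // x0 s us es; apply/(sortedP x0) => i i_s.
apply: es; rewrite ?mem_nth ?(ltnW i_s) // nth_uniq ?(ltnW i_s) //.
by rewrite neq_ltn ltnSn.
Qed.

(** Any enumeration of a clique is a path. *)
Lemma clique_in_path t (T : {set V}) : (0 < t)%N ->
  T \in cliques e t -> in_path e T (t - 1).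
Proof.
move=> t_gt0 /(cliquesP e_irr)[Tt Te]; apply/in_pathP => //; exists (enum T).
split; rewrite ?enum_uniq -?cardE ?Tt; first by lia.
- by [].
- by apply: clique_sorted (enum_uniq _) _ => x y; rewrite !mem_enum; apply: Te.
- by move=> x; rewrite mem_enum.
Qed.

Lemma clique_leq_beta t (T : {set V}) : (0 < t)%N ->
  T \in cliques e t -> (t - 1 <= beta e T)%N.
Proof. by move=> t_gt0 /(clique_in_path t_gt0)/leq_beta. Qed.

Lemma edge_card (E : {set V}) : E \in edges e -> #|E| = 2.
Proof.
case/edgesP => x [y [exy ->]]; rewrite cards2.
by case: eqP exy => // ->; rewrite e_irr.
Qed.

Lemma clique_edges t (T E : {set V}) : T \in cliques e t -> E \subset T ->
  (E \in edges e) = (#|E| == 2).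
Proof.
move=> /(cliquesP e_irr)[_ Te] ET; apply/idP/idP => [Ee|].
  by rewrite (edge_card Ee).
case/cards2P => x [y [xy EE]]; move: ET; rewrite {E}EE => /subsetP ET.
by rewrite edge_in // Te // ET // !inE eqxx ?orbT.
Qed.

(** Double counting of pairs of an edge and a clique containing it: every 2-subset of a clique is an
    edge, so each clique occurs [C(t, 2)] times. *)
Lemma sum_edges_in_cliques t (P : pred {set V}) (w : {set V} -> rat) :
  'C(t, 2)%:R * (\sum_(T in cliques e t | P T) w T)
  = \sum_(E in edges e) \sum_(T in cliques e t | P T && (E \subset T)) w T.
Proof.
rewrite (exchange_big_dep (fun T => (T \in cliques e t) && P T)) /=; last first.
  by move=> E T _ /and3P[-> ->].
rewrite big_distrr /=; apply: eq_bigr => T /andP[Tt PT].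
rewrite sumr_const -[RHS]mulr_natl; congr (_%:R * _).
have [cT _] := cliquesP e_irr _ _ Tt; rewrite -[in LHS]cT -cards_draws.
apply: eq_card => E; rewrite [LHS]inE [RHS]unfold_in Tt PT /=.
case: (boolP (E \subset T)) => ET; rewrite ?andbT ?andbF //.
by rewrite (clique_edges Tt ET).
Qed.

Lemma card_incident_edges x :
  #|[set E in edges e | ~~ [disjoint E & [set x]]]| = #|neighbours e x|.
Proof.
rewrite -(@card_in_imset _ _ (fun y => [set x; y])).
  apply: eq_card => E; rewrite inE; apply/andP/imsetP => [[Ee]|[y]].
    rewrite disjoint_sym disjoints1 negbK; case/edgesP: Ee => u [v [euv ->]].
    case/set2P => ->; [exists v | exists u]; rewrite ?inE // 1?e_sym //.
    by rewrite setUC.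
  rewrite inE => exy ->; split; first by rewrite edge_in.
  by rewrite disjoint_sym disjoints1 negbK set21.
move=> y z _ _ /set2_eq_cases[[]//|[<- ->]//].
Qed.

(* Deletes the vertices of [D] without changing the vertex type: they become
   isolated. *)
Definition isolate (D : {set V}) : rel V :=
  [rel x y | [&& x \notin D, y \notin D & e x y]].

Lemma isolate_sym D : symmetric (isolate D).
Proof. by move=> x y; rewrite /isolate /= e_sym andbCA. Qed.

Lemma isolate_irr D : irreflexive (isolate D).
Proof. by move=> x; rewrite /isolate /= e_irr !andbF. Qed.

Lemma disjointsU2 (D : {set V}) x y :
  [disjoint [set x; y] & D] = (x \notin D) && (y \notin D).
Proof. by rewrite disjoints_subset subUset !sub1set !inE. Qed.

Lemma edges_isolate D :
  edges (isolate D) = [set E in edges e | [disjoint E & D]].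
Proof.
apply/setP => E; rewrite inE; apply/edgesP/andP => [[x [y [xy ->]]]|[]].
  by rewrite edge_in // disjointsU2; case/and3P: xy => -> ->.
case/edgesP => x [y [exy ->]]; rewrite disjointsU2 => /andP[xD yD].
by exists x, y; rewrite /isolate /= xD yD.
Qed.

Lemma card_edges_isolate D : #|edges e| =
  (#|edges (isolate D)| + #|[set E in edges e | ~~ [disjoint E & D]]|)%N.
Proof.
rewrite edges_isolate -cardsUI [X in (_ + X)%N](_ : _ = 0%N) ?addn0.
  by apply: eq_card => E; rewrite !inE -andb_orr orbN andbT.
by apply: eq_card0 => E; rewrite !inE; case: [disjoint E & D]; rewrite ?andbF.
Qed.

(** A clique with a vertex in [D] would contain a second vertex adjacent to it. For [t = 1] this
    breaks down, as a vertex of [D] remains a clique by itself. *)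
Lemma cliques_isolate t D : (1 < t)%N ->
  cliques (isolate D) t = [set T in cliques e t | [disjoint T & D]].
Proof.
move=> t_gt1; apply/setP => T; rewrite [RHS]inE.
apply/(cliquesP (isolate_irr D))/andP => [[Tt TD]|[/(cliquesP e_irr)[Tt Te] dTD]].
  split; first by apply/cliquesP => //; split=> // x y xT yT /(TD _ _ xT yT)/and3P[].
  apply/pred0P => x /=; apply/negP => /andP[xT xD].
  have : (0 < #|T :\ x|)%N by move: t_gt1; rewrite -Tt (cardsD1 x T) xT.
  case/card_gt0P => y; rewrite !inE => /andP[yx yT].
  by have /and3P[] := TD _ _ yT xT yx; rewrite xD.
split=> // x y xT yT xy; rewrite /isolate /= (Te _ _ xT yT xy).
by rewrite (disjointFr dTD xT) (disjointFr dTD yT).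
Qed.

Lemma in_path_isolate D (T : {set V}) k : in_path (isolate D) T k -> in_path e T k.
Proof.
case/(in_pathP (isolate_sym D)) => s [sk us ss Ts].
apply/in_pathP => //; exists s; split=> //; apply: sub_sorted ss => x y.
by case/and3P.
Qed.

(** Scaled by [C(t, 2)], so that the bound to prove is the number of edges. *)
Definition clique_weight t := 'C(t, 2)%:R * (\sum_(T in cliques e t) p' e t T).

End Counting.

(** Cliques avoiding [D] survive the deletion; their [beta] can only drop, so their weights can only
    grow. *)
Lemma clique_weight_isolate (V : finType) (e : rel V) t (D : {set V}) :
  symmetric e -> irreflexive e -> (2 < t)%N ->
  clique_weight e t <= clique_weight (isolate e D) t
    + 'C(t, 2)%:R * (\sum_(T in cliques e t | ~~ [disjoint T & D]) p' e t T).
Proof.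
move=> e_sym e_irr t_gt2.
rewrite /clique_weight -mulrDr ler_wpM2l ?ler0n //.
rewrite (bigID (fun T : {set V} => [disjoint T & D])) /= lerD2r.
rewrite cliques_isolate ?(ltnW t_gt2) // [leRHS](eq_bigl (fun T =>
  (T \in cliques e t) && [disjoint T & D])) => [|T]; last by rewrite inE.
apply: ler_sum => T /andP[Tt dTD].
have TtD : T \in cliques (isolate e D) t.
  by rewrite cliques_isolate ?(ltnW t_gt2) // in_set Tt.
have iS := isolate_sym e_sym D; have iI := isolate_irr e_irr D.
apply: path_weight_nincr => //; first by apply: clique_leq_beta => //; lia.
apply/leq_beta => //; apply: (in_path_isolate e_sym (D := D)).
apply: (beta_in_path iS); apply: clique_in_path TtD => //; lia.
Qed.

(** * The extremal argument *)

Section Extremal.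

Variables (V : finType) (e : rel V).
Hypotheses (e_sym : symmetric e) (e_irr : irreflexive e).
Variable t : nat.
Hypothesis t_gt2 : (2 < t)%N.

Definition cliques_between (E B : {set V}) : {set {set V}} :=
  [set T in cliques e t | (E \subset T) && (T \subset B)].

(** The cliques are among the [t]-sets between [E] and [B], which the binomial counts. *)
Lemma card_cliques_between (E B : {set V}) : E \in edges e -> E \subset B ->
  (#|cliques_between E B| <= 'C(#|B| - 2, t - 2)
    ?= iff [forall T : {set V},
         (E \subset T) && (T \subset B) && (#|T| == t) ==> (T \in cliques e t)])%N.
Proof.
move=> Ee EB; have cE := edge_card e_irr Ee.
have := card_subsets_between EB; rewrite cE => <-; last exact: ltnW.
set S := [set T : {set V} | _].
have sub : cliques_between E B \subset S.
  apply/subsetP => T; rewrite /cliques_between in_set [_ \in S]in_set => /andP[Tt ->] /=.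
  by have [-> _] := cliquesP e_irr _ _ Tt.
split; first exact: subset_leq_card.
rewrite (subset_leqif_cards sub).2 eqEsubset sub /=.
apply/subsetP/forallP => [Ssub T|ST T].
  by apply/implyP => TS; have := Ssub T;
    rewrite /cliques_between in_set [_ \in S]in_set => /(_ TS) /andP[].
rewrite /cliques_between in_set [_ \in S]in_set => TS.
by have /implyP/(_ TS) -> := ST T; case/andP: TS => ->.
Qed.

(** The longest path itself covers [T], and no path exceeds it. *)
Lemma longest_path_beta x p (T : {set V}) :
  longest_path e (x :: p) -> {subset T <= x :: p} -> beta e T = size p.
Proof.
move=> [us ss smax] Tp; apply: beta_eq => //.
  by apply/in_pathP => //; exists (x :: p).
by move=> j /(in_pathP e_sym)[s [sj us' ss' _]]; have := smax _ us' ss'; rewrite sj.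
Qed.

(** * A longest path whose vertex set is closed under adjacency *)

Section Component.

Variables (x : V) (p : seq V).
Hypothesis xp_longest : longest_path e (x :: p).
Let W := [set z in x :: p].
Hypothesis W_closed : forall u w, u \in W -> e u w -> w \in W.

Lemma card_component : #|W| = (size p).+1.
Proof. by case: xp_longest => us _ _; rewrite cardsE (card_uniqP us). Qed.

Lemma meets_component T : T \in cliques e t -> ~~ [disjoint T & W] -> T \subset W.
Proof.
move=> /(cliquesP e_irr)[_ Te] /pred0Pn[u /= /andP[uT uW]].
apply/subsetP => w wT; have [<-//|uw] := eqVneq u w.
exact: W_closed uW (Te _ _ uT wT uw).
Qed.

Lemma edge_meets_component E : E \in edges e -> ~~ [disjoint E & W] -> E \subset W.
Proof.
case/edgesP => u [v [euv ->]]; rewrite disjointsU2 negb_and !negbK => uvW.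
have uW : u \in W by case/orP: uvW => // vW; apply: W_closed vW _; rewrite e_sym.
by rewrite subUset !sub1set uW (W_closed uW).
Qed.

(** Since [W] is closed, a clique meeting it lies inside it and has [beta] equal to [size p]; after
    double counting, edges missing [W] contribute nothing. *)
Lemma component_weight :
  'C(t, 2)%:R * (\sum_(T in cliques e t | ~~ [disjoint T & W]) p' e t T)
  = \sum_(E in edges e | ~~ [disjoint E & W])
      #|cliques_between E W|%:R * path_weight t (size p).
Proof.
rewrite sum_edges_in_cliques // (bigID (fun E : {set V} => ~~ [disjoint E & W])) /=.
rewrite [X in _ + X]big1 ?addr0 => [|E /andP[Ee]].
  apply: eq_bigr => E /andP[Ee EW].
  rewrite mulr_natl -sumr_const; apply: eq_big => [T|T /and3P[Tt TW _]].
    rewrite /cliques_between in_set; apply/and3P/and3P => -[Tt]; last first.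
      move=> ET TW; split=> //; apply: contra EW => TdW.
      by apply: disjointWl TdW.
    by move=> TdW ET; split=> //; apply: meets_component.
  rewrite /p' (longest_path_beta xp_longest) // => z zT.
  by have /subsetP/(_ z zT) := meets_component Tt TW; rewrite inE.
rewrite negbK => EW; rewrite big1 // => T /and3P[Tt TW ET].
have TsW := meets_component Tt TW.
have : (0 < #|E|)%N by rewrite (edge_card e_irr Ee).
case/card_gt0P => z zE; have := disjointFr EW zE.
by rewrite (subsetP (subset_trans ET TsW)).
Qed.

(** As [#|W| - 2 = size p - 1], an edge lies in at most [C(size p - 1, t - 2)] cliques, so it
    contributes at most 1. *)
Lemma component_weight_leif :
  'C(t, 2)%:R * (\sum_(T in cliques e t | ~~ [disjoint T & W]) p' e t T)
    <= #|[set E in edges e | ~~ [disjoint E & W]]|%:R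
    ?= iff [forall (E | (E \in edges e) && ~~ [disjoint E & W]),
         #|cliques_between E W|%:R * path_weight t (size p) == 1].
Proof.
rewrite component_weight -sum1dep_card natr_sum.
apply: leif_sum => E /andP[Ee EW]; apply/leif_eq.
have [leC _] := card_cliques_between Ee (edge_meets_component Ee EW).
rewrite card_component subSS in leC; rewrite /path_weight.
(* If the binomial vanishes, its inverse is 0 in [rat] and the contribution is 0. *)
case: (posnP 'C(size p - 1, t - 2)) => [->|C_gt0]; first by rewrite invr0 mulr0 ler01.
by rewrite ler_pdivrMr ?ltr0n // mul1r ler_nat.
Qed.

(** A contribution of 1 makes the binomial nonzero, whence [t <= #|W|], and makes every [t]-subset
    of [W] containing [E] a clique; one of these also contains [w]. *)
Lemma tight_edge_adj E u v w : E \in edges e -> E = [set u; v] -> E \subset W ->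
  #|cliques_between E W|%:R * path_weight t (size p) = 1 ->
  w \in W -> u != w -> (t <= (size p).+1)%N /\ e u w.
Proof.
move=> Ee EE EW; rewrite /path_weight; set C := 'C(_, _) => eq1 wW uw.
have C_gt0 : (0 < C)%N.
  rewrite lt0n; apply/eqP => C0; move: eq1.
  by rewrite C0 invr0 mulr0 => /eqP; rewrite eq_sym oner_eq0.
have tk : (t <= (size p).+1)%N by move: C_gt0; rewrite bin_gt0; lia.
split=> //.
have NC : #|cliques_between E W| = C.
  have Cn0 : C%:R != 0 :> rat by rewrite pnatr_eq0 -lt0n.
  by apply/eqP; rewrite -(eqr_nat rat) -[_%:R](divfK Cn0) eq1 mul1r.
have := (card_cliques_between Ee EW).2; rewrite card_component subSS NC eqxx.
move/esym/forallP => all_cl.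
have E3W : E :|: [set w] \subset W by rewrite subUset EW sub1set.
have cE := edge_card e_irr Ee.
(* Only an inequality, as [w] may be [v]; [t >= 3] leaves room for both cases. *)
have cE3 : (#|E :|: [set w]| <= 3)%N by rewrite cardsU cE cards1; lia.
have : (0 < #|[set T : {set V} |
    (E :|: [set w] \subset T) && (T \subset W) && (#|T| == t)]|)%N.
  by rewrite card_subsets_between ?(leq_trans cE3) // bin_gt0 card_component; lia.
case/card_gt0P => T; rewrite inE subUset sub1set => /andP[/andP[/andP[ET wT] TW] cT].
have /implyP := all_cl T; rewrite ET TW cT => /(_ isT) /(cliquesP e_irr)[_ Te].
by apply: Te => //; apply: (subsetP ET); rewrite EE set21.
Qed.

(** Equality in the sum makes every edge in [W] tight. A first edge shows that its end [a] is
    adjacent to all of [W]; then each edge from [u] to [a] is tight and does the same for [u]. *)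
Lemma tight_component :
  (exists2 E, E \in edges e & ~~ [disjoint E & W]) ->
  'C(t, 2)%:R * (\sum_(T in cliques e t | ~~ [disjoint T & W]) p' e t T)
    = #|[set E in edges e | ~~ [disjoint E & W]]|%:R ->
  (t <= (size p).+1)%N /\ {in W &, forall u v, u != v -> e u v}.
Proof.
move=> [E Ee EdW] /eqP; rewrite component_weight_leif.2 => /forall_inP tight.
have tightP F : F \in edges e -> F \subset W ->
    #|cliques_between F W|%:R * path_weight t (size p) = 1.
  move=> Fe FW; apply/eqP/tight; rewrite Fe /=; apply/negP => dF.
  have : (0 < #|F|)%N by rewrite (edge_card e_irr Fe).
  by case/card_gt0P => z zF; have := disjointFr dF zF; rewrite (subsetP FW).
have EW := edge_meets_component Ee EdW.
have /edgesP[a [b [eab EE]]] := Ee.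
have ab : a != b by apply: contraL eab => /eqP->; rewrite e_irr.
have [aW bW] : a \in W /\ b \in W by split; apply: (subsetP EW); rewrite EE ?set21 ?set22.
have adj w : w \in W -> a != w -> (t <= (size p).+1)%N /\ e a w.
  exact: tight_edge_adj Ee EE EW (tightP _ Ee EW).
split=> [|u v uW vW uv]; first by have [] := adj b bW ab.
have [ua|au] := eqVneq a u.
  by rewrite -ua in uv *; have [] := adj v vW uv.
have [_ eau] := adj u uW au.
have Fe : [set u; a] \in edges e by rewrite edge_in // e_sym.
have FW : [set u; a] \subset W by rewrite subUset !sub1set uW.
by have [] := tight_edge_adj Fe erefl FW (tightP _ Fe FW) vW uv.
Qed.

End Component.

(** * Deletion of an end of low degree *)

Lemma endpoint_weight_lt x p : longest_path e (x :: p) -> (0 < size p)%N ->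
  (#|neighbours e x|.*2 <= size p)%N ->
  'C(t, 2)%:R * (\sum_(T in cliques e t | ~~ [disjoint T & [set x]]) p' e t T)
    < #|[set E in edges e | ~~ [disjoint E & [set x]]]|%:R.
Proof.
move=> xp_longest p_gt0 deg; rewrite card_incident_edges //.
have d_gt0 : (0 < #|neighbours e x|)%N.
  case: xp_longest => _; case: p p_gt0 {deg} => //= y p _ /andP[exy _] _.
  by apply/card_gt0P; exists y; rewrite inE.
set d := #|_| in deg d_gt0 *; set k := size p in deg p_gt0 *.
(* A clique through [x] lies in the closed neighbourhood of [x], which the longest path covers, so
   all these cliques have the same weight. *)
have T_xp T : T \in cliques e t -> ~~ [disjoint T & [set x]] ->
    T \subset x |: neighbours e x.
  rewrite disjoint_sym disjoints1 negbK => /(cliquesP e_irr)[_ Te] xT.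
  apply/subsetP => z zT; rewrite !inE; have [//|zx] := eqVneq z x.
  by rewrite Te // eq_sym.
rewrite (eq_bigr (fun=> path_weight t k)) => [|T /andP[Tt Tx]]; last first.
  rewrite /p' (longest_path_beta xp_longest) // => z /(subsetP (T_xp _ Tt Tx)).
  by case/setU1P => [->|]; [rewrite mem_head | apply: longest_path_head].
rewrite sumr_const -[X in _ * X]mulr_natl; set n := #|_|.
(* Removing [x] injects the cliques through [x] into the [(t - 1)]-sets of neighbours. *)
have n_le : (n <= 'C(d, t - 1))%N.
  rewrite /n /d -cards_draws -[leqLHS](@card_in_imset _ _ (fun T => T :\ x)).
    apply/subset_leq_card/subsetP => _ /imsetP[T /andP[Tt Tx] ->].
    rewrite inE subDset T_xp //=; move: Tx; rewrite disjoint_sym disjoints1 negbK => xT.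
    have [cT _] := cliquesP e_irr _ _ Tt; have := cardsD1 x T; rewrite xT cT => ->.
    by rewrite add1n subn1.
  move=> T1 T2 /andP[_] + /andP[_].
  rewrite ![[disjoint _ & [set x]]]disjoint_sym !disjoints1 !negbK.
  by move=> xT1 xT2 /(congr1 (fun A => x |: A)) /=; rewrite !setD1K.
(* If the binomial vanishes, the left side is 0 by the convention on inverses, while the degree is
   positive. *)
rewrite /path_weight; case: (posnP 'C(k - 1, t - 2)) => [->|C_gt0].
  by rewrite invr0 !mulr0 ltr0n.
have tk : (t - 1 <= k)%N by move: C_gt0; rewrite bin_gt0; lia.
have lt_bin := bin_deletion_ineq t_gt2 d_gt0 deg tk.
rewrite mulrA ltr_pdivrMr ?ltr0n // -!natrM ltr_nat.
by apply: leq_ltn_trans lt_bin; rewrite leq_mul2l n_le orbT.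
Qed.

End Extremal.

(** * A local description of the extremal graphs, and the equality case *)

Definition clustered (V : finType) (e : rel V) (t : nat) : Prop :=
  (forall x y z, e x y -> e y z -> x != z -> e x z)
  /\ (forall x y, e x y -> (t <= #|neighbours e x|.+1)%N).

Section Clustered.

Variables (V : finType) (e : rel V).
Hypotheses (e_sym : symmetric e) (e_irr : irreflexive e).
Variable t : nat.
Hypothesis t_gt2 : (2 < t)%N.

(** No edge leaves [W], so each edge lies in the complete part [W] or survives its deletion. *)
Lemma clustered_of_isolate (W : {set V}) :
  (forall u w, u \in W -> e u w -> w \in W) ->
  {in W &, forall u v, u != v -> e u v} -> (t <= #|W|)%N ->
  clustered (isolate e W) t -> clustered e t.
Proof.
move=> W_closed W_complete tW [tr deg].
have closedE u w : e u w -> (u \in W) = (w \in W).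
  by move=> euw; apply/idP/idP => /W_closed; apply; rewrite // e_sym.
split=> [x y z exy eyz xz|x y exy].
  have [xW|xW] := boolP (x \in W).
    by apply: W_complete; rewrite // -(closedE _ _ eyz) -(closedE _ _ exy).
  have yW : y \notin W by rewrite -(closedE _ _ exy).
  have zW : z \notin W by rewrite -(closedE _ _ eyz).
  have : isolate e W x z by apply: (tr x y z) => //; rewrite /isolate /= ?xW ?yW ?zW.
  by case/and3P.
have [xW|xW] := boolP (x \in W).
  apply: leq_trans tW _; rewrite (cardsD1 x) xW add1n ltnS.
  apply/subset_leq_card/subsetP => z; rewrite !inE => /andP[zx zW].
  by apply: W_complete; rewrite // eq_sym.
have yW : y \notin W by rewrite -(closedE _ _ exy).
apply: leq_trans (deg x y _) _; first by rewrite /isolate /= xW yW.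
rewrite ltnS; apply/subset_leq_card/subsetP => z.
by rewrite !inE => /and3P[].
Qed.

Lemma clustered_complete x : clustered e t ->
  {in x |: neighbours e x &, forall u v, u != v -> e u v}.
Proof.
move=> [tr _] u v; rewrite !inE => /predU1P[->|exu] /predU1P[->|exv] uv //.
- by rewrite eqxx in uv.
- by rewrite e_sym.
- by apply: tr exv uv; rewrite e_sym.
Qed.

(** The closed neighbourhood of [x] is complete, so its enumeration is a path covering [T]. It is
    also closed under adjacency, so a path through [x] cannot leave it. *)
Lemma clustered_beta E (T : {set V}) x y : clustered e t -> E = [set x; y] ->
  e x y -> E \subset T -> T \in cliques e t ->
  T \subset x |: neighbours e x /\ beta e T = #|neighbours e x|.
Proof.
move=> cl -> exy; have [tr _] := cl; rewrite subUset !sub1set => /andP[xT yT] Tt.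
set B := x |: _.
have TB : T \subset B.
  have [_ Te] := cliquesP e_irr _ _ Tt.
  apply/subsetP => z zT; rewrite !inE; have [//|zx] := eqVneq z x.
  by rewrite Te // eq_sym.
have cB : #|B| = #|neighbours e x|.+1 by rewrite cardsU1 inE e_irr.
have B_complete : {in B &, forall u v, u != v -> e u v} := clustered_complete cl.
split=> //; apply: beta_eq => //.
  apply/in_pathP => //; exists (enum B); split; rewrite ?enum_uniq -?cardE //.
    by apply: clique_sorted (enum_uniq _) _ => u v; rewrite !mem_enum; apply: B_complete.
  by move=> z /(subsetP TB); rewrite mem_enum.
move=> j /(in_pathP e_sym)[s [sj us ss Ts]].
rewrite -ltnS -sj -cB -(card_uniqP us); apply/subset_leq_card/subsetP.
have xB : x \in B by rewrite setU11.
have B_closed u v : u \in B -> e u v -> v \in B.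
  rewrite !inE => /predU1P[->|exu] euv; first by rewrite euv orbT.
  by have [//|vx] := eqVneq v x; rewrite (tr x u v) // eq_sym.
have sub_path a q : a \in B -> path e a q -> {subset q <= B}.
  elim: q a => [|b q IHq] a aB //= /andP[eab bq] z.
  by have bB := B_closed _ _ aB eab; rewrite inE => /predU1P[->|/(IHq b bB bq)].
(* Split at [x]: the right part and the reversed left part both continue a path from [x]. *)
have : exists s1 s2, s = s1 ++ x :: s2.
  by have := Ts _ xT => /splitPr[s1 s2]; exists s1, s2.
case=> s1 [s2 Es]; move: ss; rewrite Es => ss z.
rewrite mem_cat inE => /or3P[zs1|/eqP->//|].
  have : sorted e (rev (s1 ++ x :: s2)).
    by rewrite rev_sorted (eq_sorted (e' := e)) // => a b; rewrite e_sym.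
  rewrite rev_cat rev_cons cat_rcons => /cat_sorted2[_] /= xs1.
  by apply: (sub_path x _ xB xs1); rewrite mem_rev.
by move/cat_sorted2: ss => [_] /= xs2 /(sub_path x _ xB xs2).
Qed.

(** Every edge contributes exactly 1: all [t]-sets containing it in its component are cliques, and
    their number is the nonzero binomial inverted in the weight. *)
Lemma clustered_weight : clustered e t -> clique_weight e t = #|edges e|%:R.
Proof.
move=> cl; have [tr deg] := cl.
rewrite /clique_weight (eq_bigl (fun T => (T \in cliques e t) && true))
  => [|T]; last by rewrite andbT.
rewrite sum_edges_in_cliques // -sum1_card natr_sum; apply: eq_bigr => E Ee.
have /edgesP[x [y [exy EE]]] := Ee; set B := x |: neighbours e x.
have cB : #|B| = #|neighbours e x|.+1 by rewrite cardsU1 inE e_irr.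
have EB : E \subset B by rewrite EE subUset !sub1set setU11 !inE exy orbT.
have tB := deg x y exy.
have B_complete : {in B &, forall u v, u != v -> e u v} := clustered_complete cl.
rewrite (eq_big (mem (cliques_between e t E B)) (fun=> path_weight t #|neighbours e x|)).
- rewrite sumr_const -[LHS]mulr_natl /path_weight.
  have [_] := card_cliques_between e_irr t_gt2 Ee EB.
  have -> : [forall T : {set V}, (E \subset T) && (T \subset B) && (#|T| == t)
      ==> (T \in cliques e t)].
    apply/forallP => T; apply/implyP => /andP[/andP[ET TB] /eqP cT].
    apply/cliquesP => //; split=> // u v uT vT; apply: B_complete; exact: (subsetP TB).
  move/eqP ->; rewrite cB subSS divff // pnatr_eq0 -lt0n bin_gt0; lia.
- move=> T; rewrite /cliques_between [RHS]in_set; case Tt: (T \in cliques e t) => //=.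
  by case ET: (E \subset T) => //=; have [-> _] := clustered_beta cl EE exy ET Tt.
- by move=> T /and3P[Tt _ ET]; rewrite /p'; have [_ ->] := clustered_beta cl EE exy ET Tt.
Qed.

(** The blocks are the closed neighbourhoods, so block sizes translate into degrees. Conversely they
    are the classes of equality-or-adjacency. *)
Lemma disjoint_union_of_completeP : disjoint_union_of_complete e t <-> clustered e t.
Proof.
split=> [[P [Ppart cP eP]]|[tr deg]].
  have [/eqP covP tiP _] := and3P Ppart.
  have blockE B x y : B \in P -> x \in B -> e x y = (x != y) && (y \in B).
    move=> BP xB; rewrite eP; case: eqP => //= _; apply/exists_inP/idP.
      case=> B' B'P /andP[xB' yB'].
      by rewrite -(def_pblock tiP BP xB) (def_pblock tiP B'P xB').
    by move=> yB; exists B; rewrite // xB.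
  have inblock x : exists2 B, B \in P & x \in B.
    by apply/bigcupP; rewrite -/(cover P) covP inE.
  split=> [x y z|x y]; have [B BP xB] := inblock x; rewrite (blockE B x _ BP xB).
    case/andP=> _ yB; rewrite (blockE B y z BP yB) => /andP[_ zB] xz.
    by rewrite (blockE B x _ BP xB) xz.
  case/andP=> xy yB; have -> : neighbours e x = B :\ x.
    by apply/setP => z; rewrite !inE (blockE B) // eq_sym.
  (* A block of size 1 is impossible, as it holds both [x] and [y]. *)
  have := cP B BP; rewrite (cardsD1 x) xB add1n => -[//|] [] /eqP.
  rewrite cards_eq0 => /eqP/setP/(_ y); rewrite !inE yB eq_sym xy.
  by [].
pose R := [rel x y | (x == y) || e x y].
have eqR : {in [set: V] & &, equivalence_rel R}.
  move=> x y z _ _ _ /=; rewrite eqxx; split=> //.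
  case: (eqVneq x y) => [->//|xy] /= exy.
  case: (eqVneq x z) => [<-|xz]; first by rewrite e_sym exy orbT.
  case: (eqVneq y z) => [<-|yz] //=.
  apply/idP/idP => [exz|eyz]; last exact: tr exy eyz xz.
  by apply: tr exz yz; rewrite e_sym.
have Ppart := equivalence_partitionP eqR.
exists (equivalence_partition R setT); split=> //.
  move=> B /imsetP[x _ ->].
  have -> : [set y in setT | R x y] = x |: neighbours e x.
    by apply/setP => y; rewrite !inE /= eq_sym.
  rewrite cardsU1 inE e_irr add1n.
  case: (set_0Vmem (neighbours e x)) => [->|[y]]; first by right; rewrite cards0.
  by rewrite inE => /deg; left.
move=> x y; have [->|xy] /= := eqVneq x y; first exact: e_irr.
apply/idP/exists_inP => [exy|[B BP /andP[xB yB]]].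
  exists (pblock (equivalence_partition R setT) x).
    by rewrite pblock_mem // (cover_partition Ppart) inE.
  by rewrite !pblock_equivalence_partition ?inE //= eqxx exy orbT.
have [_ tiP _] := and3P Ppart.
have := pblock_equivalence_partition eqR (in_setT x) (in_setT y).
by rewrite (def_pblock tiP BP xB) yB /= (negbTE xy) /= => <-.
Qed.

End Clustered.

(** * Induction on the number of edges *)

Lemma clique_weight_bound (V : finType) (t : nat) (e : rel V) :
  (2 < t)%N -> symmetric e -> irreflexive e ->
  clique_weight e t <= #|edges e|%:R
    /\ (clique_weight e t = #|edges e|%:R -> clustered e t).
Proof.
move=> t_gt2; have [n] := ubnP #|edges e|.
elim: n e => // n IHn e /ltnSE le_n e_sym e_irr.
have [E0|/set0Pn[E /edgesP[x0 [y0 [exy _]]]]] := eqVneq (edges e) set0.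
  have noe x y : e x y = false by rewrite -edge_in // E0 inE.
  split=> [|_]; last by split=> x y => [z|]; rewrite noe.
  rewrite E0 cards0 /clique_weight big1 ?mulr0 // => T Tt.
  have [cT Te] := cliquesP e_irr _ _ Tt.
  have : (1 < #|T|)%N by rewrite cT ltnW.
  by case/card_gt1P => x [y [xT yT xy]]; have := Te _ _ xT yT xy; rewrite noe.
(* The induction hypothesis applies to every deletion that destroys an edge. *)
have step (D : {set V}) : (0 < #|[set E in edges e | ~~ [disjoint E & D]]|)%N ->
    clique_weight (isolate e D) t <= #|edges (isolate e D)|%:R
    /\ (clique_weight (isolate e D) t = #|edges (isolate e D)|%:R
        -> clustered (isolate e D) t).
  move=> D_gt0; apply: IHn; last exact: isolate_irr; last exact: isolate_sym.
  by apply: leq_trans le_n; rewrite (card_edges_isolate e_sym D) -[ltnLHS]addn0 ltn_add2l.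
have delete_endpoint x p : longest_path e (x :: p) -> (0 < size p)%N ->
    (#|neighbours e x|.*2 <= size p)%N -> clique_weight e t < #|edges e|%:R.
  move=> xp p_gt0 deg; have lt := endpoint_weight_lt e_sym e_irr t_gt2 xp p_gt0 deg.
  have le := clique_weight_isolate [set x] e_sym e_irr t_gt2.
  rewrite (card_edges_isolate e_sym [set x]) natrD.
  apply: le_lt_trans le _; apply: ler_ltD lt.
  apply: (step _ _).1; rewrite card_incident_edges //.
  case: xp => _; case: p p_gt0 {deg} => //= y p _ /andP[exy' _] _.
  by apply/card_gt0P; exists y; rewrite inE.
have [x [p [p_gt0 xp]]] := exists_longest_path e_irr exy.
have lt_conclude : clique_weight e t < #|edges e|%:R ->
    clique_weight e t <= #|edges e|%:R
    /\ (clique_weight e t = #|edges e|%:R -> clustered e t).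
  by move=> lt; split=> [|eq]; [apply: ltW | rewrite eq ltxx in lt].
(* If the degrees sum to at most [size p], one end has at most half of it; for the last vertex the
   path is reversed. *)
have [deg|deg] := leqP (#|neighbours e x| + #|neighbours e (last x p)|)%N (size p).
  apply: lt_conclude.
  have [dx|dy] := leqP #|neighbours e x|.*2 (size p); first exact: delete_endpoint dx.
  apply: (delete_endpoint (last x p) (rev (belast x p))).
  - by rewrite -rev_rcons -lastI; apply: longest_path_rev.
  - by rewrite size_rev size_belast.
  - by rewrite size_rev size_belast; lia.
have [us ss _] := xp.
have [c [uc cc cxp]] := spanning_cycle e_sym e_irr us ss
  (longest_path_head e_sym xp) (longest_path_last e_sym xp) deg.
have closed := spanning_cycle_closed e_sym xp uc cc cxp.
pose W := [set z in x :: p].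
have W_closed u w : u \in W -> e u w -> w \in W by rewrite !inE; apply: closed.
have some_edge : exists2 E, E \in edges e & ~~ [disjoint E & W].
  case: p p_gt0 ss @W {xp deg us cxp closed W_closed} => //= y p _ /andP[exy' _].
  by exists [set x; y]; rewrite ?edge_in // disjointsU2 negb_and !negbK !inE eqxx.
have W_gt0 : (0 < #|[set E in edges e | ~~ [disjoint E & W]]|)%N.
  by case: some_edge => F Fe FW; apply/card_gt0P; exists F; rewrite in_set Fe.
have le := clique_weight_isolate W e_sym e_irr t_gt2.
have [le1 eq1] := step W W_gt0.
have leW := (component_weight_leif e_sym e_irr t_gt2 xp W_closed).1.
have tight := tight_component e_sym e_irr t_gt2 xp W_closed some_edge.
rewrite -/W in leW tight.
rewrite (card_edges_isolate e_sym W) natrD; split=> [|eq].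
  by apply: le_trans le _; apply: lerD.
(* Both parts obey their bounds, so equality of the totals forces equality in each. *)
have [eqI eqW] : clique_weight (isolate e W) t = #|edges (isolate e W)|%:R
   /\ 'C(t, 2)%:R * (\sum_(T in cliques e t | ~~ [disjoint T & W]) p' e t T)
      = #|[set E in edges e | ~~ [disjoint E & W]]|%:R.
  by move: le le1 leW eq; do 2!move: (clique_weight _ _) => ?; split; lra.
have [tk W_complete] := tight eqW.
apply: clustered_of_isolate W_closed W_complete _ (eq1 eqI) => //.
by rewrite cardsE (card_uniqP us).
Qed.

Theorem theorem4p4 (t : nat) (t_ge3 : (3 <= t)%N)
    (V : finType) (e : rel V) (e_sym : symmetric e) (e_irr : irreflexive e)
    (m : nat) (card_edges : #|edges e| = m) :
  [/\ (* p' is well defined: the maximum is attained and the binomial is nonzero *)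
      forall T : {set V}, T \in cliques e t ->
        [/\ in_path e T (beta e T),
            forall k : nat, in_path e T k -> (k <= beta e T)%N
          & 'C(beta e T - 1, t - 2) <> 0%N],
      (* p' is decreasing as a function of beta *)
      forall b b' : nat, (t - 1 <= b)%N -> (b < b')%N ->
        path_weight t b' < path_weight t b,
      \sum_(T in cliques e t) p' e t T <= m%:R / ('C(t, 2))%:R
    & \sum_(T in cliques e t) p' e t T = m%:R / ('C(t, 2))%:R
        <-> disjoint_union_of_complete e t].
Proof.
have C_gt0 : 0 < 'C(t, 2)%:R :> rat by rewrite ltr0n bin_gt0 ltnW.
have [bound tight] := clique_weight_bound t_ge3 e_sym e_irr.
rewrite card_edges in bound tight.
split.
- move=> T Tt; have Tp := clique_in_path e_sym e_irr (ltnW (ltnW t_ge3)) Tt.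
  split; [exact: (beta_in_path e_sym Tp) | exact: leq_beta |].
  apply/eqP; rewrite -lt0n bin_gt0; have := leq_beta e_sym Tp; lia.
- exact: path_weight_anti.
(* Dividing by [C(t, 2)] undoes the scaling in [clique_weight]. *)
- by rewrite ler_pdivlMr // mulrC.
- rewrite disjoint_union_of_completeP //; split=> [eq|cl].
    by apply: tight; rewrite /clique_weight eq mulrC divfK ?gt_eqF.
  apply: (mulfI (lt0r_neq0 C_gt0)); rewrite mulrCA divff ?lt0r_neq0 // mulr1.
  by rewrite -card_edges; apply: clustered_weight.
Qed.
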